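(* A lattice simplex $\Delta$ is (isomorphic to) a free join $\Delta_1\circ_{\mathbb{Z}}\Delta_2$ of lattice simplices $\Delta_1$ and $\Delta_2$ if and only if the corresponding linear code $C_\Delta$ is (isomorphic to) the direct sum $C_{\Delta_1}\oplus C_{\Delta_2}$.
   Context: Let $M\cong\mathbb{Z}^d$ be a lattice and $\Delta$ a $d$-dimensional lattice simplex in $M\otimes\mathbb{R}$ with vertices $v_0,\dots,v_d\in M$. Lattice simplices are isomorphic if an affine unimodular transformation maps one to the other. The free join of lattice polytopes $\Delta_1,\Delta_2$ of dimensions $d_1,d_2$ is $\Delta_1\circ_{\mathbb{Z}}\Delta_2=\operatorname{conv}(\Delta_1\times\{0^{d_2}\}\times\{0\},\ \{0^{d_1}\}\times\Delta_2\times\{1\})\subset\mathbb{R}^{d_1+d_2+1}$. Code of a simplex: $\mathbb{Z}_N=\mathbb{Z}/N\mathbb{Z}$. Let $\Lambda_\Delta=\{x\in(\mathbb{R}/\mathbb{Z})^{d+1}:\sum_i\{x_i\}(v_i,1)\in M\oplus\mathbb{Z}\}$, where $\{\cdot\}$ is the fractional part. $N_\Delta$ is the least common multiple of the denominators of all coordinates of elements of $\Lambda_\Delta$, and $C_\Delta=\{(N_\Delta\{x_0\},\dots,N_\Delta\{x_d\}):x\in\Lambda_\Delta\}\subseteq\mathbb{Z}_{N_\Delta}^{d+1}$. Codes over the same $\mathbb{Z}_N$ and of the same length are isomorphic if they coincide after a permutation of coordinates. It is known that two lattice simplices are isomorphic if and only if their codes are. Direct sum: for codes $C_1$ over $\mathbb{Z}_{N_1}$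 and $C_2$ over $\mathbb{Z}_{N_2}$, with $L=\operatorname{lcm}(N_1,N_2)$, $C_1\oplus C_2$ is the code over $\mathbb{Z}_L$ consisting of all concatenations $\frac{L}{N_1}c_1\,|\,\frac{L}{N_2}c_2$, $c_1\in C_1$, $c_2\in C_2$. *)

(* Defs.v *)
From HB Require Import structures.
From mathcomp Require Import all_boot all_order all_algebra all_fingroup.
From mathcomp Require Import all_classical all_reals.
From mathcomp Require Import convex.
Set Implicit Arguments.
Unset Strict Implicit.
Unset Printing Implicit Defensive.
Import Order.TTheory GRing.Theory Num.Theory.
Local Open Scope classical_set_scope.
Local Open Scope ring_scope.

(* The lattice M is Z^d = 'rV[int]_d, and M (x) R is 'rV[R]_d. *)
Definition latR (R : realType) (m n : nat) (A : 'M[int]_(m, n)) : 'M[R]_(m, n) :=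
  map_mx intr A.
Arguments latR R {m n} A.

Record lattice_simplex (R : realType) (d : nat) := LatticeSimplex {
  vertex : 'I_d.+1 -> 'rV[int]_d;
  vertex_affinely_independent : forall a : 'I_d.+1 -> R,
    \sum_i a i = 0 -> \sum_i a i *: latR R (vertex i) = 0 ->
    forall i, a i = 0 }.

Definition convex_hull (R : realType) (n : nat) (A : set 'rV[R]_n) : set 'rV[R]_n :=
  smallest (@convex_set R 'rV[R]_n) A.

Definition polytope (R : realType) (d : nat) (D : lattice_simplex R d) :
    set 'rV[R]_d :=
  convex_hull (range (fun i => latR R (vertex D i))).

(* Row vectors are acted on from the right. Over int, unitmx means that the
   determinant is 1 or -1. *)
Definition lattice_iso (R : realType) (d d' : nat)
    (P : set 'rV[R]_d) (Q : set 'rV[R]_d') : Prop :=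
  exists (e : d = d') (U : 'M[int]_d') (t : 'rV[int]_d'),
    U \in unitmx /\
    Q = [set castmx (erefl, e) x *m latR R U + latR R t | x in P].

Definition free_join (R : realType) (d1 d2 : nat)
    (P1 : set 'rV[R]_d1) (P2 : set 'rV[R]_d2) : set 'rV[R]_(d1 + d2 + 1) :=
  convex_hull ([set row_mx (row_mx x 0) (const_mx 0) | x in P1] `|`
        [set row_mx (row_mx 0 y) (const_mx 1) | y in P2]).

Definition frac_part (R : realType) (x : R) : R := x - (Num.floor x)%:~R.

(* A subset of (R/Z)^(d+1) is represented by its Z^(d+1)-periodic preimage in
   R^(d+1): the condition only involves fractional parts. *)
Definition Lambda (R : realType) (d : nat) (D : lattice_simplex R d) :
    set 'rV[R]_d.+1 :=
  [set x | exists m : 'rV[int]_(d + 1),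
     \sum_i frac_part (x 0 i) *: row_mx (latR R (vertex D i)) (const_mx 1) =
     latR R m].

(* The generator of the ideal of common multiples; it is 0 when there is no
   positive common multiple. *)
Definition lcm_set (S : set nat) : nat :=
  xget 0%N [set N | (forall n, S n -> n %| N)%N /\
                    (forall m, (forall n, S n -> n %| m) -> N %| m)%N].

Lemma lcm_setP (S : set nat) :
  (forall n, S n -> n %| lcm_set S)%N /\
  (forall m, (forall n, S n -> n %| m) -> lcm_set S %| m)%N.
Proof.
apply: (@xgetPex _ 0%N [set N | (forall n, S n -> n %| N)%N /\
                    (forall m, (forall n, S n -> n %| m) -> N %| m)%N]).
have [[M [M0 HM]]|H] :=
    pselect (exists M, (0 < M)%N /\ (forall n, S n -> n %| M)%N).
  have ex : exists n, `[< (0 < n)%N /\ (forall k, S k -> k %| n)%N >].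
    by exists M; apply/asboolP.
  case: (ex_minnP ex) => N /asboolP [N0 HN] Nmin.
  exists N; split => // m Hm; rewrite /dvdn -leqn0 leqNgt; apply/negP => r0.
  suff : (N <= m %% N)%N by rewrite leqNgt ltn_mod N0.
  apply: Nmin; apply/asboolP; split => // k Sk.
  by have := Hm _ Sk; rewrite {1}(divn_eq m N) dvdn_addr// dvdn_mull// HN.
exists 0%N; split => [n|m Hm]; first by rewrite dvdn0.
by case: m Hm => // m Hm; exfalso; apply: H; exists m.+1.
Qed.

Definition denominators (R : realType) (d : nat) (D : lattice_simplex R d) :
    set nat :=
  [set n | exists x i, Lambda D x /\
     exists q : rat, x 0 i = ratr q /\ n = `|denq q|%N].

Definition code_modulus (R : realType) (d : nat) (D : lattice_simplex R d) : nat :=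
  lcm_set (denominators D).

(* Z/NZ for every N > 0, including N = 1, which 'Z_N does not cover. *)
Notation Zmod N := 'I_N.-1.+1.

Definition zcode (N n : nat) := set 'rV[Zmod N]_n.

Definition code_of (R : realType) (d : nat) (D : lattice_simplex R d) :
    zcode (code_modulus D) d.+1 :=
  [set c : 'rV[Zmod (code_modulus D)]_d.+1 | exists x, Lambda D x /\
     forall i, (c 0 i : nat)%:R = (code_modulus D)%:R * frac_part (x 0 i)].

Arguments code_of {R d} D.

Definition cast_Zmod (N N' : nat) (e : N = N') : Zmod N -> Zmod N' :=
  cast_ord (congr1 (fun k => k.-1.+1) e).

Definition code_iso (N n N' n' : nat) (C : zcode N n) (C' : zcode N' n') : Prop :=
  exists (eN : N = N') (en : n = n') (s : 'S_n'),
    C' = [set col_perm s (castmx (erefl, en) (map_mx (cast_Zmod eN) c)) | c in C].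

Definition rescale (N L : nat) (a : Zmod N) : Zmod L := inZp (L %/ N * a)%N.

Definition direct_sum (N1 n1 N2 n2 : nat) (C1 : zcode N1 n1) (C2 : zcode N2 n2) :
    zcode (lcmn N1 N2) (n1 + n2) :=
  [set row_mx (map_mx (@rescale N1 (lcmn N1 N2)) c1)
              (map_mx (@rescale N2 (lcmn N1 N2)) c2) | c1 in C1 & c2 in C2].

(* Main.v *)
(* Let V be the homogeneous vertex matrix of a simplex, with rows (1, v_i).  Then
   Lambda = Z^(d+1) V^-1, so Lambda determines V up to right multiplication by a
   unimodular matrix, that is, it determines the vertices up to a unimodular affine
   map; and the vertices are determined up to order by their convex hull.  The code
   is Lambda modulo Z^(d+1) written in units of 1/N, where N is the exponent of this
   finite group.  Hence both isomorphism of simplices and isomorphism of codes mean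
   that the lattices Lambda agree up to a permutation of coordinates.  The free join
   of two simplices is again a simplex, and its Lambda is the product of theirs; as
   the exponent of a product is the lcm of the exponents, its code is the direct
   sum. *)
Require Import Defs.
From mathcomp Require Import all_boot all_order all_algebra all_fingroup.
From mathcomp Require Import all_classical all_reals.
From mathcomp Require Import interval_inference convex.
Set Implicit Arguments.
Unset Strict Implicit.
Unset Printing Implicit Defensive.
Import Order.TTheory GRing.Theory Num.Theory.
Local Open Scope classical_set_scope.
Local Open Scope ring_scope.

(** * Convex hulls of finite families and recovery of their vertices *)

Definition affinely_independent (R : realType) (n k : nat)
    (v : 'I_k -> 'rV[R]_n) : Prop :=
  forall a : 'I_k -> R, \sum_i a i = 0 -> \sum_i a i *: v i = 0 ->
  forall i, a i = 0.

Lemma convex_setP (R : realType) n (A : set 'rV[R]_n) :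
  @convex_set R 'rV[R]_n A <->
  forall x y (t : R), 0 <= t <= 1 -> A x -> A y -> A (t *: x + (1 - t) *: y).
Proof.
split=> [cA x y t /andP[t0 t1] Ax Ay|cA x y t].
  have := cA x y (Itv01 t0 t1); rewrite !inE; exact.
rewrite !inE => Ax Ay; apply: cA => //.
by rewrite ge0 le1.
Qed.

Lemma convex_hull_convex (R : realType) n (A : set 'rV[R]_n) :
  @convex_set R 'rV[R]_n (convex_hull A).
Proof.
apply/convex_setP => x y t t01 Ax Ay B [cB AB].
by move/convex_setP: (cB); apply=> //; [apply: Ax|apply: Ay].
Qed.

Lemma convex_set_sum (R : realType) n (A : set 'rV[R]_n) k
    (v : 'I_k -> 'rV[R]_n) (a : 'I_k -> R) :
  @convex_set R 'rV[R]_n A -> (forall i, A (v i)) -> (forall i, 0 <= a i) ->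
  \sum_i a i = 1 -> A (\sum_i a i *: v i).
Proof.
move=> /convex_setP cA.
(* Dividing by the total weight, rather than assuming it is 1, makes the claim stable under dropping
   the last point, so that induction on [k] applies. *)
suff scaled : (forall i, A (v i)) -> (forall i, 0 <= a i) -> 0 < \sum_i a i ->
    A ((\sum_i a i)^-1 *: \sum_i a i *: v i).
  by move=> Av a0 a1; have := scaled Av a0; rewrite a1 invr1 scale1r; apply.
elim: k v a => [|k IH] v a Av a0; first by rewrite big_ord0 ltxx.
rewrite !big_ord_recr /=.
set s := \sum_(i < k) _; set b := a ord_max => s0.
have sge0 : 0 <= s by apply: sumr_ge0.
(* If the first [k] weights sum to 0 they all vanish and only the last point remains. Otherwise the
   point from the induction hypothesis and the last point are mixed in the ratio [s : b]. *)
have [sE|sN0] := eqVneq s 0.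
  have aE (i : 'I_k) : a (widen_ord (leqnSn k) i) = 0.
    by apply: (psumr_eq0P _ sE).
  rewrite big1 ?add0r => [|i _]; last by rewrite aE scale0r.
  rewrite sE add0r in s0 *.
  by rewrite scalerA mulVf ?scale1r ?gt_eqF.
have spos : 0 < s by rewrite lt_neqAle eq_sym sN0.
have t01 : 0 <= s / (s + b) <= 1.
  by rewrite ler_pdivrMr // mul1r lerDl a0 andbT divr_ge0 // ltW.
pose inj := widen_ord (leqnSn k).
have := cA _ _ _ t01 (IH _ _ (fun i => Av (inj i)) (fun i => a0 _) spos)
  (Av ord_max).
rewrite -/s scalerA; set S := \sum_(i < k) _.
have -> : s / (s + b) * s^-1 = (s + b)^-1.
  by rewrite mulrAC divff ?mul1r.
have -> : 1 - s / (s + b) = (s + b)^-1 * b.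
  by rewrite -{1}(divff (lt0r_neq0 s0)) -mulrBl addrAC subrr add0r mulrC.
by rewrite -scalerA -scalerDr.
Qed.

Lemma convex_hull_range (R : realType) n k (v : 'I_k -> 'rV[R]_n) x :
  convex_hull (range v) x <->
  exists a : 'I_k -> R,
    [/\ forall i, 0 <= a i, \sum_i a i = 1 & x = \sum_i a i *: v i].
Proof.
split=> [|[a [a0 a1 ->]]]; last first.
  apply: convex_set_sum => // [|i]; first exact: convex_hull_convex.
  by apply: sub_gen_smallest; exists i.
pose B := [set x | exists a : 'I_k -> R,
  [/\ forall i, 0 <= a i, \sum_i a i = 1 & x = \sum_i a i *: v i]].
apply: (@smallest_sub _ _ _ B).
  apply/convex_setP => _ _ t /andP[t0 t1] [a [a0 a1 ->]] [b [b0 b1 ->]].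
  exists (fun i => t * a i + (1 - t) * b i); split.
  - by move=> i; rewrite addr_ge0 // mulr_ge0 // subr_ge0.
  - by rewrite big_split /= -!mulr_sumr a1 b1 !mulr1 addrC subrK.
  - rewrite !scaler_sumr -big_split; apply: eq_bigr => i _ /=.
    by rewrite [RHS]scalerDl !scalerA.
move=> _ [i _ <-]; exists (fun j => (j == i)%:R); split.
- by move=> j; rewrite ler0n.
- by rewrite (bigD1 i) //= eqxx big1 ?addr0 // => j /negbTE ->.
- rewrite (bigD1 i) //= eqxx scale1r big1 ?addr0 // => j /negbTE ->.
  by rewrite scale0r.
Qed.

Lemma affine_sum (R : realType) m n k (v : 'I_k -> 'rV[R]_m) (a : 'I_k -> R)
    (A : 'M[R]_(m, n)) (b : 'rV[R]_n) : \sum_i a i = 1 ->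
  (\sum_i a i *: v i) *m A + b = \sum_i a i *: (v i *m A + b).
Proof.
move=> a1; rewrite -{1}[b]scale1r -a1 scaler_suml mulmx_suml -big_split.
by apply: eq_bigr => i _ /=; rewrite scalerDr scalemxAl.
Qed.

Lemma affine_image_hull (R : realType) m n k (v : 'I_k -> 'rV[R]_m)
    (A : 'M[R]_(m, n)) (b : 'rV[R]_n) :
  [set x *m A + b | x in convex_hull (range v)] =
  convex_hull (range (fun i => v i *m A + b)).
Proof.
apply/seteqP; split=> x.
  case=> _ /convex_hull_range[a [a0 a1 ->]] <-.
  by apply/convex_hull_range; exists a; split=> //; apply: affine_sum.
case/convex_hull_range=> a [a0 a1 ->].
exists (\sum_i a i *: v i); last exact: affine_sum.
by apply/convex_hull_range; exists a.
Qed.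

Lemma affinely_independent_eq (R : realType) n k (v : 'I_k -> 'rV[R]_n)
    (a b : 'I_k -> R) : affinely_independent v ->
  \sum_i a i = \sum_i b i -> \sum_i a i *: v i = \sum_i b i *: v i -> a =1 b.
Proof.
move=> vI abE abvE i; apply/eqP; rewrite -subr_eq0; apply/eqP.
apply: (vI (fun i => a i - b i)); first by rewrite sumrB abE subrr.
under eq_bigr do rewrite scalerBl.
by rewrite sumrB abvE subrr.
Qed.

(** Barycentric coordinates are unique, and the [i]-th point has the [i]-th unit vector as its
    coordinates. *)
Lemma affinely_independent_inj (R : realType) n k (v : 'I_k -> 'rV[R]_n) :
  affinely_independent v -> injective v.
Proof.
move=> vI i j vij; apply/eqP; apply: contraT => ij.
have delta (l : 'I_k) : \sum_m (m == l)%:R = 1 :> R.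
  by rewrite (bigD1 l) //= eqxx big1 ?addr0 // => m /negbTE ->.
have deltav (l : 'I_k) : \sum_m (m == l)%:R *: v m = v l.
  rewrite (bigD1 l) //= eqxx scale1r big1 ?addr0 // => m /negbTE ->.
  by rewrite scale0r.
have := @affinely_independent_eq R n k v
  (fun m => (m == i)%:R) (fun m => (m == j)%:R) vI.
rewrite !delta !deltav => /(_ erefl vij i); rewrite eqxx (negbTE ij) => /eqP.
by rewrite oner_eq0.
Qed.

(* Writing the points of each family as convex combinations of the other gives
   mutually inverse nonnegative matrices; wherever the first has a nonzero
   entry, the second has a row of the identity. *)
Lemma convex_hull_vertices (R : realType) n k (v w : 'I_k -> 'rV[R]_n) :
  affinely_independent v -> affinely_independent w ->
  convex_hull (range v) = convex_hull (range w) ->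
  exists s : 'S_k, forall i, w i = v (s i).
Proof.
move=> vI wI vwE.
have /choice[a aP] j : exists f : 'I_k -> R,
    [/\ forall i, 0 <= f i, \sum_i f i = 1 & w j = \sum_i f i *: v i].
  by apply/convex_hull_range; rewrite vwE; apply: sub_gen_smallest; exists j.
have /choice[b bP] i : exists f : 'I_k -> R,
    [/\ forall j, 0 <= f j, \sum_j f j = 1 & v i = \sum_j f j *: w j].
  by apply/convex_hull_range; rewrite -vwE; apply: sub_gen_smallest; exists i.
have abE j l : \sum_i a j i * b i l = (l == j)%:R.
  move: l; apply: (affinely_independent_eq wI).
    rewrite exchange_big [RHS](bigD1 j) //= eqxx [X in _ = _ + X]big1 ?addr0;
      last by move=> l /negbTE ->.
    have [_ a1 _] := aP j; rewrite -a1; apply: eq_bigr => i _.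
    by rewrite -mulr_sumr; have [_ -> _] := bP i; rewrite mulr1.
  rewrite [RHS](bigD1 j) //= eqxx scale1r [X in _ = _ + X]big1 ?addr0;
    last by move=> l /negbTE ->; rewrite scale0r.
  have [_ _ ->] := aP j.
  under eq_bigr do rewrite scaler_suml.
  rewrite exchange_big; apply: eq_bigr => i _ /=.
  have [_ _ ->] := bP i.
  by rewrite scaler_sumr; apply: eq_bigr => l _; rewrite scalerA.
have vw j : exists i, w j = v i.
  have [a0 a1 _] := aP j.
  have [i aji] : exists i, a j i != 0.
    apply: contrapT => H.
    have : \sum_i a j i = 0.
      apply: big1 => i _; apply/eqP; apply: contraT => ai.
      by case: H; exists i.
    by move/eqP; rewrite a1 oner_eq0.
  exists i; have [b0 b1 ->] := bP i.
  (* The off-diagonal entry of the product is a zero sum of nonnegative terms, so every term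
     vanishes, and [a j i] is a nonzero factor. As the row sums to 1, it is then a row of the
     identity. *)
  have bil l : l != j -> b i l = 0.
    move=> lj; have := abE j l; rewrite (negbTE lj) => /psumr_eq0P /(_ i).
    have ge0 m : 0 <= a j m * b m l by rewrite mulr_ge0 //; have [] := bP m.
    move=> /(_ (fun m _ => ge0 m) isT) /eqP.
    by rewrite mulf_eq0 (negbTE aji) => /eqP.
  have bij : b i j = 1.
    by rewrite -b1 (bigD1 j) //= big1 ?addr0.
  rewrite (bigD1 j) //= bij scale1r big1 ?addr0 // => l lj.
  by rewrite bil // scale0r.
have [s sE] := choice vw.
have s_inj : injective s.
  move=> i j sij; apply: (affinely_independent_inj wI).
  by rewrite sE (sE j) sij.
by exists (perm s_inj) => i; rewrite permE.
Qed.

(** * The lattice Lambda of a simplex *)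

Lemma latR_inj (R : realType) m n : injective (@latR R m n).
Proof.
move=> A B /matrixP AB; apply/matrixP => i j.
by have := AB i j; rewrite !mxE => /intr_inj.
Qed.

Lemma latRM (R : realType) m n p (A : 'M[int]_(m, n)) (B : 'M[int]_(n, p)) :
  latR R (A *m B) = latR R A *m latR R B.
Proof. exact: map_mxM. Qed.

Lemma latR_int (R : realType) m n (A : 'M[R]_(m, n)) :
  (forall i j, A i j \is a Num.int) <-> exists B, A = latR R B.
Proof.
split=> [Aint|[B ->] i j]; last by rewrite mxE intr_int.
exists (map_mx Num.floor A); apply/matrixP => i j.
by rewrite !mxE floorK.
Qed.

Lemma frac_part_int (R : realType) (x : R) : x - frac_part x \is a Num.int.
Proof. by rewrite opprB addrC subrK intr_int. Qed.

(** Serves to exchange fractional parts for the coordinates themselves in integrality conditions. *)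
Lemma int_sum_congr (R : realType) (I : finType) (x y : I -> R) (z : I -> int) :
  (forall i, x i - y i \is a Num.int) ->
  (\sum_i x i * (z i)%:~R \is a Num.int) =
  (\sum_i y i * (z i)%:~R \is a Num.int).
Proof.
move=> xy.
have -> : \sum_i x i * (z i)%:~R =
    \sum_i y i * (z i)%:~R + \sum_i (x i - y i) * (z i)%:~R.
  by rewrite -big_split; apply: eq_bigr => i _ /=; rewrite -mulrDl addrC subrK.
by apply: rpredDr; apply: rpred_sum => i _; rewrite rpredM // intr_int.
Qed.

(** Since the vertices are integral, replacing [frac_part (x 0 i)] by [x 0 i] changes each sum by an
    integer only; the fractional parts thus drop out of the definition. *)
Lemma Lambda_coordP (R : realType) d (D : lattice_simplex R d) x :
  Lambda D x <->
  (forall j, \sum_i x 0 i * (vertex D i 0 j)%:~R \is a Num.int) /\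
  \sum_i x 0 i \is a Num.int.
Proof.
have fracE i : x 0 i - frac_part (x 0 i) \is a Num.int.
  exact: frac_part_int.
have sumE : (\sum_i x 0 i \is a Num.int) =
    (\sum_i frac_part (x 0 i) \is a Num.int).
  have := @int_sum_congr _ _ _ _ (fun=> 1) fracE.
  under eq_bigr do rewrite mulr1.
  by under [in X in _ = X -> _]eq_bigr do rewrite mulr1.
rewrite sumE; pose S := \sum_i frac_part (x 0 i) *: row_mx (latR R (vertex D i))
  (const_mx 1 : 'rV[R]_1).
have Sl j : S 0 (lshift 1 j) =
    \sum_i frac_part (x 0 i) * (vertex D i 0 j)%:~R.
  by rewrite summxE; apply: eq_bigr => i _; rewrite mxE row_mxEl mxE.
have Sr j : S 0 (rshift d j) = \sum_i frac_part (x 0 i).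
  by rewrite summxE; apply: eq_bigr => i _; rewrite mxE row_mxEr mxE mulr1.
split=> [/latR_int Sint|[xv x1]].
  split=> [j|]; last by rewrite -(Sr ord0) Sint.
  by rewrite (int_sum_congr _ fracE) -Sl Sint.
apply/latR_int => i j; rewrite ord1; case: (split_ordP j) => j' ->.
  by rewrite Sl -(int_sum_congr _ fracE).
by rewrite Sr.
Qed.

(** The ones form the first column, not the last as in [Lambda]: [1 + d] then reduces to [d.+1], so
    the matrix is square without a cast, and affine maps become block upper triangular. *)
Definition homogeneous_vertices (R : realType) d (D : lattice_simplex R d) :
    'M[int]_d.+1 :=
  \matrix_(i < d.+1) (row_mx (const_mx 1 : 'rV_1) (vertex D i) : 'rV_(1 + d)).

Lemma homogeneous_vertices_mul (R : realType) d (D : lattice_simplex R d)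
    (x : 'rV[R]_d.+1) :
  x *m latR R (homogeneous_vertices D) =
  row_mx (const_mx (\sum_i x 0 i) : 'rV_1)
         (\sum_i x 0 i *: latR R (vertex D i)).
Proof.
apply/rowP => j; rewrite [LHS]mxE; case: (@split_ordP 1 d j) => j' ->.
  rewrite (@row_mxEl _ _ 1 d) [RHS]mxE; apply: eq_bigr => i _.
  by rewrite 2!mxE (@row_mxEl _ _ 1 d) mxE mulr1.
rewrite (@row_mxEr _ _ 1 d) summxE; apply: eq_bigr => i _.
by rewrite 2!mxE (@row_mxEr _ _ 1 d) !mxE.
Qed.

(** A vector in the left kernel is an affine dependence among the vertices, the column of ones
    recording the sum of its coefficients. *)
Lemma homogeneous_vertices_unit (R : realType) d (D : lattice_simplex R d) :
  latR R (homogeneous_vertices D) \in unitmx.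
Proof.
rewrite -row_free_unit; apply: inj_row_free => x.
rewrite homogeneous_vertices_mul -[X in _ = X -> _](row_mx0 _ 1 1 d) => /(@eq_row_mx _ 1 1 d)[x1 xv].
apply/rowP => i; rewrite mxE.
apply: (@vertex_affinely_independent _ _ D (x 0)) => //.
by move/matrixP/(_ 0 0): x1; rewrite !mxE.
Qed.

Lemma LambdaP (R : realType) d (D : lattice_simplex R d) x :
  Lambda D x <->
  exists m, x *m latR R (homogeneous_vertices D) = latR R m.
Proof.
rewrite Lambda_coordP -latR_int homogeneous_vertices_mul.
split=> [[xv x1] i j|H].
  case: (@split_ordP 1 d j) => j' ->; first by rewrite (@row_mxEl _ _ 1 d) mxE.
  rewrite (@row_mxEr _ _ 1 d) ord1 summxE.
  by under eq_bigr do rewrite !mxE.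
split=> [j|].
  have := H 0 (rshift 1 j); rewrite (@row_mxEr _ _ 1 d) summxE.
  by under eq_bigr do rewrite !mxE.
by have := H 0 (lshift d (0 : 'I_1)); rewrite (@row_mxEl _ _ 1 d) mxE.
Qed.

(** By Cramer's rule: multiplying [x *m V = m] by the integral adjugate gives [\det V * x] integral.
    This bound makes the coordinates rational and the code modulus positive. *)
Lemma Lambda_bounded (R : realType) d (D : lattice_simplex R d) :
  exists2 M, (0 < M)%N & forall x, Lambda D x ->
  forall i, M%:R * x 0 i \is a Num.int.
Proof.
set V := homogeneous_vertices D.
have V0 : \det V != 0.
  have := homogeneous_vertices_unit D; rewrite unitmxE -/V unitfE det_map_mx.
  by rewrite intr_eq0.
exists `|\det V|%N => [|x /LambdaP[m xm] i]; first by rewrite absz_gt0.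
suff : (\det V)%:~R * x 0 i \is a Num.int.
  move=> H; rewrite natr_absz intr_norm.
  by case: ger0P => // _; rewrite mulNr rpredN.
have : x *m latR R V *m latR R (\adj V) = latR R (m *m \adj V).
  by rewrite xm latRM.
rewrite -mulmxA -latRM mul_mx_adj => xE.
suff <- : (x *m latR R (\det V)%:M) 0 i = (\det V)%:~R * x 0 i.
  by rewrite xE mxE intr_int.
by rewrite /latR map_scalar_mx mul_mx_scalar mxE.
Qed.

Lemma Lambda_periodic (R : realType) d (D : lattice_simplex R d)
    (x y : 'rV[R]_d.+1) :
  (forall i, x 0 i - y 0 i \is a Num.int) -> Lambda D x -> Lambda D y.
Proof.
move=> xy; rewrite !Lambda_coordP => -[xv x1]; split=> [j|].
  by rewrite -(int_sum_congr _ xy).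
have := int_sum_congr (fun=> 1) xy.
under eq_bigr do rewrite mulr1.
under [in X in _ = X -> _]eq_bigr do rewrite mulr1.
by rewrite x1.
Qed.

(** * Affine equivalence of simplices in terms of [Lambda] *)

Lemma affinely_independent_vertices (R : realType) d (D : lattice_simplex R d) :
  affinely_independent (fun i => latR R (vertex D i)).
Proof. exact: (@vertex_affinely_independent _ _ D). Qed.

Lemma affinely_independent_affine_image (R : realType) n k
    (v : 'I_k -> 'rV[R]_n) (A : 'M[R]_n) b :
  A \in unitmx -> affinely_independent v ->
  affinely_independent (fun i => v i *m A + b).
Proof.
move=> uA vI a a0 av; apply: vI => //.
move: av; under eq_bigr do rewrite scalerDr scalemxAl.
rewrite big_split /= -scaler_suml a0 scale0r addr0 -mulmx_suml.
by move/(congr1 (mulmx^~ (invmx A))); rewrite mul0mx mulmxK.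
Qed.

Definition simplex_affine_equiv (R : realType) d (D D' : lattice_simplex R d) :=
  exists (s : 'S_d.+1) (U : 'M[int]_d) (t : 'rV[int]_d), U \in unitmx /\
  forall i, vertex D' i = vertex D (s i) *m U + t.

Lemma latR_unit (R : realType) n (U : 'M[int]_n) :
  U \in unitmx -> latR R U \in unitmx.
Proof. by rewrite !unitmxE det_map_mx; apply: rmorph_unit. Qed.

Lemma latR_affine (R : realType) m n (v : 'rV[int]_m) (U : 'M[int]_(m, n)) t :
  latR R (v *m U + t) = latR R v *m latR R U + latR R t.
Proof. by rewrite /latR map_mxD map_mxM. Qed.

(** The affine image of a hull is the hull of the image points, and a hull determines its affinely
    independent generators up to order; this order is the permutation in [simplex_affine_equiv]. *)
Lemma lattice_iso_vertices (R : realType) d (D D' : lattice_simplex R d) :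
  lattice_iso (polytope D) (polytope D') <-> simplex_affine_equiv D D'.
Proof.
split.
  case=> e [U [t [uU]]]; rewrite (eq_irrelevance e erefl) => PE.
  have := affinely_independent_affine_image (b := latR R t) (latR_unit R uU)
    (@affinely_independent_vertices _ _ D).
  move=> /convex_hull_vertices/(_ (@affinely_independent_vertices _ _ D')).
  case=> [|s sE]; first by rewrite -affine_image_hull.
  exists s, U, t; split=> // i; apply: (@latR_inj R).
  by rewrite sE latR_affine.
case=> s [U [t [uU vE]]]; exists erefl, U, t; split=> //.
transitivity [set x *m latR R U + latR R t | x in polytope D] => //.
rewrite affine_image_hull /polytope; congr convex_hull.
apply/seteqP; split=> _ [i _ <-].
  by exists (s i) => //; rewrite vE latR_affine.
by exists ((s^-1)%g i) => //; rewrite vE latR_affine permKV.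
Qed.

Lemma homogeneous_vertices_affine (R : realType) d (D D' : lattice_simplex R d)
    (s : 'S_d.+1) (U : 'M[int]_d) (t : 'rV[int]_d) :
  (forall i, vertex D' i = vertex D (s i) *m U + t) <->
  homogeneous_vertices D' =
    row_perm s (homogeneous_vertices D) *m (block_mx 1%:M t 0 U : 'M_(1 + d)).
Proof.
have rowE i : row i (row_perm s (homogeneous_vertices D) *m
    (block_mx 1%:M t 0 U : 'M_(1 + d))) =
    row_mx (const_mx 1 : 'rV_1) (vertex D (s i) *m U + t).
  rewrite row_mul.
  have -> : row i (row_perm s (homogeneous_vertices D)) =
      row (s i) (homogeneous_vertices D).
    by apply/rowP => j; rewrite !mxE.
  rewrite rowK (@mul_row_block _ 1 1 d 1 d) mulmx1 mulmx0 addr0 addrC.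
  by congr row_mx; congr (_ + _); apply/rowP => j; rewrite mxE big_ord1 mxE mul1r.
split=> [vE|VE i].
  by apply/row_matrixP => i; rewrite rowE rowK vE.
have := rowK (fun i => row_mx (const_mx 1 : 'rV_1) (vertex D' i) : 'rV_(1 + d)) i.
rewrite -/(homogeneous_vertices D') VE rowE => /(@eq_row_mx _ 1 1 d)[_].
by move=> ->.
Qed.

Lemma mul_col_row_perm (R : pzRingType) m n p (s : 'S_n) (A : 'M[R]_(m, n))
    (B : 'M[R]_(n, p)) : col_perm s A *m row_perm s B = A *m B.
Proof.
by rewrite row_permE col_permE mulmxA -(mulmxA A) -perm_mxM mulVg perm_mx1 mulmx1.
Qed.

Lemma latR_row_perm (R : realType) m n (s : 'S_m) (A : 'M[int]_(m, n)) :
  latR R (row_perm s A) = row_perm s (latR R A).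
Proof. exact: map_row_perm. Qed.

(** Permuting the coordinates of [x] undoes the permutation of the rows of the vertex matrix, and
    multiplying by the unimodular [W] does not affect integrality. *)
Lemma Lambda_affine_equiv (R : realType) d (D D' : lattice_simplex R d) :
  simplex_affine_equiv D D' ->
  exists s : 'S_d.+1, forall x, Lambda D x <-> Lambda D' (col_perm s x).
Proof.
case=> s [U [t [uU /homogeneous_vertices_affine VE]]]; exists s => x.
set W := block_mx _ _ _ _ in VE.
have uW : W \in unitmx by rewrite unitmxE det_ublock det1 mul1r -unitmxE.
rewrite !LambdaP VE latRM latR_row_perm mulmxA mul_col_row_perm.
split=> -[m mE]; first by exists (m *m W); rewrite mE latRM.
exists (m *m invmx W); rewrite latRM -mE -mulmxA -latRM mulmxV //.
by rewrite /latR map_mx1 mulmx1.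
Qed.

(** Used to show that a change of vertex matrix fixes the first basis column, hence is affine. *)
Lemma homogeneous_vertices_col0 (R : realType) d (D : lattice_simplex R d) :
  homogeneous_vertices D *m (col_mx 1%:M 0 : 'M_(1 + d, 1)) = const_mx 1.
Proof.
apply/row_matrixP => i; rewrite row_mul rowK (@mul_row_col _ 1 1 d 1) mulmx1 mulmx0 addr0.
by apply/rowP => j; rewrite !mxE.
Qed.

(* The rows of the inverse of the vertex matrix generate the lattice Lambda, so
   equal lattices have vertex matrices differing by a unimodular W; both
   matrices have a constant column of ones, so W is an affine map. *)
Lemma affine_equiv_Lambda (R : realType) d (D D' : lattice_simplex R d)
    (s : 'S_d.+1) :
  (forall x, Lambda D x <-> Lambda D' (col_perm s x)) ->
  simplex_affine_equiv D D'.
Proof.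
move=> LE.
set V := homogeneous_vertices D; set V' := homogeneous_vertices D'.
have uV : latR R V \in unitmx := homogeneous_vertices_unit D.
(* One inclusion of lattices already yields an integral transition matrix: the rows of the inverse
   of the first vertex matrix lie in its lattice, hence in the other one up to [p]. Both inclusions
   give [W] and its inverse. *)
have transition (E E' : lattice_simplex R d) (p : 'S_d.+1) :
    (forall x, Lambda E x -> Lambda E' (col_perm p x)) -> exists W : 'M[int]_d.+1,
    row_perm p^-1 (homogeneous_vertices E') = homogeneous_vertices E *m W.
  set A := homogeneous_vertices E; set A' := homogeneous_vertices E' => EE'.
  have uA : latR R A \in unitmx := homogeneous_vertices_unit E.
  have rowA i : exists m, row i (invmx (latR R A) *m row_perm p^-1 (latR R A')) =
      latR R m.
    have : Lambda E (row i (invmx (latR R A))).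
      apply/LambdaP; exists (row i 1%:M).
      by rewrite -row_mul mulVmx // /latR map_row map_mx1.
    move/EE'/LambdaP=> [m mE]; exists m.
    by rewrite -mE -/A' row_mul -(mul_col_row_perm p) -row_permM mulgV row_perm1.
  have [W WE] : exists W, invmx (latR R A) *m row_perm p^-1 (latR R A') =
      latR R W.
    apply/latR_int => i j; have [m mE] := rowA i.
    by move/rowP/(_ j): mE; rewrite mxE => ->; rewrite mxE intr_int.
  exists W; apply: (@latR_inj R).
  by rewrite latR_row_perm latRM -WE mulKVmx.
have [W WE] := transition D D' s (fun x => (LE x).1).
have [|W' WE'] := transition D' D s^-1%g.
  move=> x Lx; apply/LE; rewrite -col_permM.
  by rewrite mulgV col_perm1.
rewrite -/V -/V' invgK in WE WE'.
have uW : W \in unitmx.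
  suff /mulmx1_unit[] : W *m W' = 1%:M by [].
  apply: (@latR_inj R).
  have : latR R V *m latR R (W *m W') = latR R V.
    rewrite -latRM mulmxA -WE; apply: congr1.
    have : row_perm s^-1 (row_perm s V) = row_perm s^-1 (V' *m W').
      by rewrite WE'.
    rewrite -row_permM mulVg row_perm1 => ->.
    by rewrite !row_permE mulmxA.
  by move/(congr1 (mulmx (invmx (latR R V)))); rewrite mulKmx // mulVmx //
    /latR map_mx1.
pose U := drsubmx (W : 'M_(1 + d)); pose t := ursubmx (W : 'M_(1 + d)).
(* Multiplied by [V] on the left, both sides become the column of ones, which is invariant under row
   permutations; [V] is then cancelled. *)
have W0 : W *m (col_mx 1%:M 0 : 'M_(1 + d, 1)) =
    (col_mx 1%:M 0 : 'M_(1 + d, 1)).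
  apply: (@latR_inj R); apply: (can_inj (mulKmx uV)).
  rewrite -!latRM homogeneous_vertices_col0 mulmxA -WE row_permE -mulmxA.
  rewrite homogeneous_vertices_col0 -row_permE; congr latR.
  by apply/matrixP => i j; rewrite !mxE.
have WB : W = block_mx 1%:M t 0 U :> 'M_(1 + d).
  move: W0; rewrite -[W in LHS](@submxK _ 1 d 1 d).
  rewrite (@mul_block_col _ 1 d 1 d 1) !mulmx1 !mulmx0.
  rewrite !addr0 => /(@eq_col_mx _ 1 d 1)[W1 W0].
  by rewrite -[LHS](@submxK _ 1 d 1 d) W1 W0.
exists s, U, t; split.
  by move: uW; rewrite WB !unitmxE (@det_ublock _ 1 d) det1 mul1r.
apply/homogeneous_vertices_affine; rewrite -WB -/V -/V'.
rewrite row_permE -mulmxA -WE -row_permE.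
by rewrite -row_permM mulgV row_perm1.
Qed.

(** * Periodic lattices and their codes *)

(* The divisibility clause says that N is the exponent of L modulo Z^n. *)
Definition encodes (R : realType) n N (L : set 'rV[R]_n) (C : zcode N n) :=
  [/\ (0 < N)%N, L 0,
      forall x y : 'rV[R]_n, (forall i, x 0 i - y 0 i \is a Num.int) -> L x -> L y,
      forall M, (N %| M)%N <->
        forall x, L x -> forall i, M%:R * x 0 i \is a Num.int &
      forall c : 'rV[Zmod N]_n, C c <-> L (\row_i ((c 0 i)%:R / N%:R))].

Lemma Zmod_lt N (a : Zmod N) : (0 < N)%N -> (a < N)%N.
Proof. by move=> /prednK {2}<-. Qed.

Lemma frac_part_itv (R : realType) (x : R) : 0 <= frac_part x < 1.
Proof.
by rewrite subr_ge0 floor_le ltrBlDr addrC; have := floorD1_gt x; rewrite intrD.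
Qed.

Lemma frac_part_id (R : realType) (x : R) : 0 <= x < 1 -> frac_part x = x.
Proof.
by move=> x01; rewrite /frac_part (@floor_def _ _ 0) ?subr0.
Qed.

Lemma Zmod_div_itv (R : realType) N (a : Zmod N) : (0 < N)%N ->
  0 <= (a%:R / N%:R : R) < 1.
Proof.
move=> N0; rewrite divr_ge0 ?ler0n //= ltr_pdivrMr ?ltr0n // mul1r ltr_nat.
exact: Zmod_lt.
Qed.

(** The exponent clause makes [N] times each fractional part a natural number below [N], that is, an
    element of [Zmod N]; periodicity keeps the reduced point in [L]. *)
Lemma encodes_frac (R : realType) n N (L : set 'rV[R]_n) (C : zcode N n) x :
  encodes L C -> L x ->
  exists2 c, C c & forall i, frac_part (x 0 i) = (c 0 i)%:R / N%:R.
Proof.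
move=> [N0 _ Lper LN LC] Lx.
have N0R : N%:R != 0 :> R by rewrite pnatr_eq0 -lt0n.
pose f i := N%:R * frac_part (x 0 i).
have f_nat i : f i \is a Num.nat.
  have [f0 _] := andP (frac_part_itv (x 0 i)).
  rewrite natrEint mulr_ge0 ?ler0n // andbT /f mulrBr.
  apply: rpredB; first exact: (LN N).1 (dvdnn N) _ Lx i.
  by rewrite rpredM ?intr_int ?rpred_nat.
have f_lt i : (Num.truncn (f i) < N.-1.+1)%N.
  rewrite prednK // -(ltr_nat R) truncnK // -[ltRHS]mulr1 ltr_pM2l ?ltr0n //.
  by case/andP: (frac_part_itv (x 0 i)).
pose c : 'rV[Zmod N]_n := \row_i inord (Num.truncn (f i)).
have cE i : frac_part (x 0 i) = (c 0 i)%:R / N%:R.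
  by rewrite mxE inordK // truncnK // /f mulrAC divff ?mul1r.
exists c => //; apply/LC; apply: Lper Lx => i.
by rewrite mxE -cE frac_part_int.
Qed.

(** Code and lattice determine each other: every point of [L] is, modulo integers, a codeword
    divided by [N], and [N] itself is read off from [L]. *)
Lemma code_iso_encodes (R : realType) n N (L : set 'rV[R]_n) (C : zcode N n)
    n' N' (L' : set 'rV[R]_n') (C' : zcode N' n') :
  encodes L C -> encodes L' C' ->
  code_iso C C' <->
  exists (e : n = n') (s : 'S_n'),
    forall x, L x <-> L' (col_perm s (castmx (erefl, e) x)).
Proof.
move=> LC L'C'; split.
  case=> eN [en [s CE]]; exists en, s => x.
  case: _ / en s C' L' CE L'C' => s C' L' CE L'C'.
  case: _ / eN C' CE L'C' => C' CE L'C'.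
  have {}CE : C' = [set col_perm s c | c in C].
    rewrite CE; apply: eq_imagel => c _; congr col_perm.
    by apply/rowP => i; rewrite castmxE !mxE; apply: val_inj; rewrite /= !cast_ord_id.
  rewrite castmx_id.
  have [_ _ Lper _ LCE] := LC; have [_ _ Lper' _ LCE'] := L'C'.
  split=> Lx.
    have [c Cc cE] := encodes_frac LC Lx.
    apply: (Lper' (\row_i ((col_perm s c 0 i)%:R / N%:R))) => [i|].
      by rewrite !mxE -cE -opprB rpredN frac_part_int.
    by apply/LCE'; rewrite CE; exists c.
  have [c' ] := encodes_frac L'C' Lx.
  rewrite CE => -[c Cc <-] cE.
  apply: (Lper (\row_i ((c 0 i)%:R / N%:R))) => [i|]; last exact/LCE.
  have := cE (s^-1%g i); rewrite !mxE permKV => <-.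
  by rewrite -opprB rpredN frac_part_int.
case=> en; case: _ / en C' L' L'C' => C' L' L'C' [s LE].
have {}LE x : L x <-> L' (col_perm s x) by rewrite LE castmx_id.
have [N0 _ _ LN LCE] := LC; have [N0' _ _ LN' LCE'] := L'C'.
(* Each modulus divides the other, because the multipliers that make a lattice integral do not
   change when coordinates are permuted. *)
have eN : N = N'.
  apply/eqP; rewrite eqn_dvd; apply/andP; split.
    apply/LN => x /LE Lx i; have := (LN' N').1 (dvdnn _) _ Lx (s^-1%g i).
    by rewrite mxE permKV.
  apply/LN' => x Lx i; have Lx' : L (col_perm s^-1 x).
    by apply/LE; rewrite -col_permM mulgV col_perm1.
  by have := (LN N).1 (dvdnn _) _ Lx' (s i); rewrite mxE permK.
case: _ / eN C' L'C' LN' LCE' N0' => C' L'C' LN' LCE' N0'.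
exists erefl, erefl, s.
have castE (c : 'rV[Zmod N]_n) :
    col_perm s (castmx (erefl, erefl) (map_mx (cast_Zmod erefl) c)) = col_perm s c.
  congr col_perm; apply/rowP => i.
  by rewrite castmxE !mxE; apply: val_inj; rewrite /= !cast_ord_id.
apply/seteqP; split=> [c Cc|_ [c Cc <-]].
  exists (col_perm s^-1 c); last by rewrite castE -col_permM mulgV col_perm1.
  apply/LCE/LE; move/LCE': Cc; congr L'; apply/rowP => i.
  by rewrite !mxE permK.
rewrite castE; apply/LCE'; move/LCE/LE: Cc; congr L'; apply/rowP => i.
by rewrite !mxE.
Qed.

(** Numerator and denominator are coprime, so a denominator dividing [M] times the numerator divides
    [M]. *)
Lemma denq_dvd (R : realType) (q : rat) (M : nat) :
  (`|denq q| %| M)%N = (M%:R * ratr q \is a @Num.int R).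
Proof.
have -> : M%:R * ratr q = ratr (M%:R * q) :> R by rewrite rmorphM rmorph_nat.
apply/idP/idP => [/dvdnP[k ->]|].
  have -> : (k * `|denq q|)%:R * q = k%:R * (numq q)%:~R.
    rewrite natrM -mulrA; congr (_ * _).
    by rewrite natr_absz gtr0_norm ?denq_gt0 // mulrC -numqE.
  by rewrite rmorphM rmorph_nat /= ratr_int rpredM ?rpred_nat ?intr_int.
case/intrP => z; rewrite -(ratr_int R) => /fmorph_inj.
rewrite -{1}[q]divq_num_den mulrA => /(congr1 (fun x => x * (denq q)%:~R)).
rewrite mulfVK ?intr_eq0 ?denq_neq0 // -intrM -[M%:R]/(M%:~R) -intrM.
move/intr_inj => Mz.
rewrite -(@Gauss_dvdr _ `|numq q|); last first.
  by rewrite coprime_sym coprime_num_den.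
rewrite mulnC -[M]/`|M%:Z|%N -abszM Mz abszM.
exact: dvdn_mull.
Qed.

Lemma encodes_code_of (R : realType) d (D : lattice_simplex R d) :
  encodes (Lambda D) (code_of D).
Proof.
have [M0 M0gt M0P] := Lambda_bounded D.
(* [denominators] only sees rational coordinates; here every coordinate of a point of [Lambda] turns
   out to be one. *)
have rational x i : Lambda D x -> exists q : rat, x 0 i = ratr q.
  move=> /M0P/(_ i)/intrP[z zE]; exists (z%:~R / M0%:R).
  rewrite fmorph_div /= ratr_int rmorph_nat -zE mulrAC divff ?mul1r //.
  by rewrite pnatr_eq0 -lt0n.
have modP M : (code_modulus D %| M)%N <->
    forall x, Lambda D x -> forall i, M%:R * x 0 i \is a Num.int.
  have [dvd_lcm lcm_dvd] := lcm_setP (denominators D).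
  split=> [NM x Lx i|H].
    have [q qE] := rational x i Lx.
    rewrite qE -denq_dvd; apply: dvdn_trans NM; apply: dvd_lcm.
    by exists x, i; split=> //; exists q.
  apply: lcm_dvd => _ [x [i [Lx [q [qE ->]]]]].
  by rewrite (denq_dvd R) -qE H.
(* The value 0 of [lcm_set] is excluded, as the modulus divides the positive bound [M0]. *)
have N0 : (0 < code_modulus D)%N.
  by have /modP := M0P; apply: dvdn_gt0.
have L0 : Lambda D 0.
  by apply/LambdaP; exists 0; rewrite mul0mx /latR map_mx0.
split=> // [x y|c]; first exact: Lambda_periodic.
have NR : (code_modulus D)%:R != 0 :> R by rewrite pnatr_eq0 -lt0n.
split=> [[x [Lx cE]]|Lc].
  apply: Lambda_periodic Lx => i.
  by rewrite mxE cE mulrAC divff // mul1r frac_part_int.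
eexists; split; first exact: Lc.
move=> i; rewrite mxE frac_part_id; last exact: Zmod_div_itv.
by rewrite mulrCA divff ?mulr1.
Qed.

(** * Rescaling and direct sums of codes *)

Lemma rescale_val N K (a : Zmod N) : (0 < N)%N -> (0 < K)%N -> (N %| K)%N ->
  rescale K a = (K %/ N * a)%N :> nat.
Proof.
move=> N0 K0 NK; rewrite /= (prednK K0) modn_small // -[ltnRHS](divnK NK).
by rewrite ltn_pmul2l ?Zmod_lt // divn_gt0 // dvdn_leq.
Qed.

Lemma rescale_div (R : realType) N K (a : Zmod N) :
  (0 < N)%N -> (0 < K)%N -> (N %| K)%N ->
  (rescale K a)%:R / K%:R = a%:R / N%:R :> R.
Proof.
move=> N0 K0 NK; rewrite rescale_val // -[in X in _ / X](divnK NK) !natrM.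
have ? : N%:R != 0 :> R by rewrite pnatr_eq0 -lt0n.
have ? : (K %/ N)%:R != 0 :> R by rewrite pnatr_eq0 -lt0n divn_gt0 // dvdn_leq.
by rewrite -mulf_div divff // mul1r.
Qed.

Definition set_join (R : realType) n1 n2 (L1 : set 'rV[R]_n1)
    (L2 : set 'rV[R]_n2) : set 'rV[R]_(n1 + n2) :=
  [set x | L1 (lsubmx x) /\ L2 (rsubmx x)].

(** Rescaling leaves the fractions unchanged. Conversely, a point of [L] with entries over [K] also
    has entries over [N], and equality of the two fractions in [0,1) identifies the numerators. *)
Lemma encodes_rescale (R : realType) n N K (L : set 'rV[R]_n) (C : zcode N n)
    (c : 'rV[Zmod K]_n) : encodes L C -> (0 < K)%N -> (N %| K)%N ->
  L (\row_i ((c 0 i)%:R / K%:R)) <->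
  exists2 c0, C c0 & map_mx (@rescale N K) c0 = c.
Proof.
move=> LC K0 NK; have [N0 _ Lper _ LCE] := LC; split=> [Lc|[c0 Cc0 <-]].
  have [c0 Cc0 c0E] := encodes_frac LC Lc; exists c0 => //.
  apply/rowP => i; apply: val_inj.
  have /eqP := c0E i; rewrite mxE frac_part_id; last exact: Zmod_div_itv.
  rewrite -(rescale_div _ _ N0 K0 NK) => /eqP/mulIf H.
  apply/eqP; rewrite -(eqr_nat R) [map_mx _ _ _ _]mxE eq_sym; apply/eqP/H.
  by rewrite invr_eq0 pnatr_eq0 -lt0n.
move/LCE: Cc0; congr L; apply/rowP => i.
by rewrite !mxE rescale_div.
Qed.

Lemma encodes_direct_sum (R : realType) n1 N1 (L1 : set 'rV[R]_n1)
    (C1 : zcode N1 n1) n2 N2 (L2 : set 'rV[R]_n2) (C2 : zcode N2 n2) :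
  encodes L1 C1 -> encodes L2 C2 -> encodes (set_join L1 L2) (direct_sum C1 C2).
Proof.
move=> LC1 LC2.
have [N10 L10 Lper1 LN1 _] := LC1; have [N20 L20 Lper2 LN2 _] := LC2.
have K0 : (0 < lcmn N1 N2)%N by rewrite lcmn_gt0 N10.
split=> //.
- by rewrite /set_join /= !linear0.
- move=> x y xy [Lx1 Lx2]; split; [apply: Lper1 Lx1|apply: Lper2 Lx2] => i;
    by rewrite !mxE.
- move=> M; rewrite dvdn_lcm; split.
    move=> /andP[/LN1 M1 /LN2 M2] x [Lx1 Lx2] i.
    case: (split_ordP i) => j ->.
      by have := M1 _ Lx1 j; rewrite mxE.
    by have := M2 _ Lx2 j; rewrite mxE.
  (* Each lattice embeds in the product by padding with 0, which lies in the other lattice. *)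
  move=> H; apply/andP; split; [apply/LN1 => x Lx i|apply/LN2 => x Lx i].
    have := H (row_mx x 0); rewrite /set_join /= row_mxKl row_mxKr.
    by move=> /(_ (conj Lx L20) (lshift _ i)); rewrite row_mxEl.
  have := H (row_mx 0 x); rewrite /set_join /= row_mxKl row_mxKr.
  by move=> /(_ (conj L10 Lx) (rshift _ i)); rewrite row_mxEr.
- move=> c.
  have lE : lsubmx (\row_i ((c 0 i)%:R / (lcmn N1 N2)%:R)) =
      \row_i ((lsubmx c 0 i)%:R / (lcmn N1 N2)%:R) :> 'rV[R]_n1.
    by apply/rowP => i; rewrite !mxE.
  have rE : rsubmx (\row_i ((c 0 i)%:R / (lcmn N1 N2)%:R)) =
      \row_i ((rsubmx c 0 i)%:R / (lcmn N1 N2)%:R) :> 'rV[R]_n2.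
    by apply/rowP => i; rewrite !mxE.
  rewrite /set_join /= lE rE (encodes_rescale _ LC1 K0 (dvdn_lcml _ _)).
  rewrite (encodes_rescale _ LC2 K0 (dvdn_lcmr _ _)); split.
    case=> c1 Cc1 [c2 Cc2 <-]; rewrite row_mxKl row_mxKr.
    by split; [exists c1|exists c2].
  case=> -[c1 Cc1 c1E] [c2 Cc2 c2E].
  by exists c1 => //; exists c2 => //; rewrite c1E c2E hsubmxK.
Qed.

(** * The free join as a simplex *)

Lemma latR_row_mx (R : realType) m n1 n2 (A : 'M[R]_(m, n1)) (B : 'M_(m, n2)) :
  (exists M, row_mx A B = latR R M) <->
  (exists M, A = latR R M) /\ (exists M, B = latR R M).
Proof.
split=> [[M ME]|[[M1 ->] [M2 ->]]].
  split; [exists (lsubmx M)|exists (rsubmx M)].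
    by rewrite -[LHS](row_mxKl _ B) ME /latR map_lsubmx.
  by rewrite -[LHS](row_mxKr A) ME /latR map_rsubmx.
by exists (row_mx M1 M2); rewrite /latR map_row_mx.
Qed.

Lemma Lambda_sumP (R : realType) d (D : lattice_simplex R d) x :
  Lambda D x <->
  (exists m, \sum_i x 0 i *: latR R (vertex D i) = latR R m) /\
  \sum_i x 0 i \is a Num.int.
Proof.
rewrite Lambda_coordP -latR_int; split=> -[xv x1]; split=> //.
  move=> i j; rewrite ord1 summxE.
  by under eq_bigr do rewrite !mxE.
move=> j; have := xv 0 j; rewrite summxE.
by under eq_bigr do rewrite !mxE.
Qed.

Definition join_vertex (R : realType) d1 d2 (D1 : lattice_simplex R d1)
    (D2 : lattice_simplex R d2) (i : 'I_(d1.+1 + d2.+1)) :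
    'rV[int]_(d1 + d2 + 1) :=
  match fintype.split i with
  | inl j => row_mx (row_mx (vertex D1 j) 0) (const_mx 0)
  | inr j => row_mx (row_mx 0 (vertex D2 j)) (const_mx 1)
  end.

Lemma join_vertex_sum (R : realType) d1 d2 (D1 : lattice_simplex R d1)
    (D2 : lattice_simplex R d2) (a : 'I_(d1.+1 + d2.+1) -> R) :
  \sum_i a i *: latR R (join_vertex D1 D2 i) =
  row_mx (row_mx (\sum_i a (lshift _ i) *: latR R (vertex D1 i))
                 (\sum_i a (rshift _ i) *: latR R (vertex D2 i)))
         (const_mx (\sum_i a (rshift _ i))).
Proof.
rewrite big_split_ord /=.
under eq_bigr do rewrite /join_vertex (unsplitK (inl _)).
under [X in _ + X = _]eq_bigr do rewrite /join_vertex (unsplitK (inr _)).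
apply/rowP => j; rewrite mxE !summxE.
case: (split_ordP j) => {}j ->.
  rewrite row_mxEl; case: (split_ordP j) => {}j ->.
    rewrite row_mxEl summxE [X in _ + X]big1 ?addr0.
      by apply: eq_bigr => i _; rewrite 2!mxE !row_mxEl [in RHS]mxE mxE.
    by move=> i _; rewrite 2!mxE row_mxEl row_mxEl mxE mulr0.
  rewrite row_mxEr summxE [X in X + _]big1 ?add0r.
    by apply: eq_bigr => i _; rewrite 2!mxE row_mxEl row_mxEr [in RHS]mxE mxE.
  by move=> i _; rewrite 2!mxE row_mxEl row_mxEr mxE mulr0.
rewrite row_mxEr [RHS]mxE [X in X + _]big1 ?add0r.
  by apply: eq_bigr => i _; rewrite 2!mxE row_mxEr mxE mulr1.
by move=> i _; rewrite 2!mxE row_mxEr mxE mulr0.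
Qed.

Lemma join_dim d1 d2 : (d1 + d2 + 1).+1 = (d1.+1 + d2.+1)%N.
Proof. by rewrite addn1 addSn addnS. Qed.

Lemma sum_cast_ord (V : nmodType) n m (e : n = m) (F : 'I_n -> V) :
  \sum_i F i = \sum_(i < m) F (cast_ord (esym e) i).
Proof.
apply: reindex; exists (cast_ord e) => j _; first exact: cast_ordKV.
exact: cast_ordK.
Qed.

(** The last coordinate of a dependence is the sum of its second block of coefficients, so both
    blocks sum to 0 and are affine dependences of [D1] and [D2] separately. *)
Lemma join_affinely_independent (R : realType) d1 d2 (D1 : lattice_simplex R d1)
    (D2 : lattice_simplex R d2) (a : 'I_(d1 + d2 + 1).+1 -> R) :
  \sum_i a i = 0 ->
  \sum_i a i *: latR R (join_vertex D1 D2 (cast_ord (join_dim d1 d2) i)) = 0 ->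
  forall i, a i = 0.
Proof.
move=> a0 av.
pose b (i : 'I_(d1.+1 + d2.+1)) := a (cast_ord (esym (join_dim d1 d2)) i).
suff b0 i : b i = 0.
  by move=> i; rewrite -(b0 (cast_ord (join_dim d1 d2) i)) /b cast_ordK.
move: a0 av; rewrite !(sum_cast_ord (join_dim d1 d2)).
under [in X in _ -> X -> _]eq_bigr do rewrite cast_ordKV.
rewrite join_vertex_sum -[X in _ -> _ = X -> _]row_mx0 => b0 /eq_row_mx[].
rewrite -[X in _ = X -> _]row_mx0 => /eq_row_mx[b1v b2v] /matrixP/(_ 0 0).
rewrite !mxE => b21.
have b2 j : b (rshift d1.+1 j) = 0.
  exact: (@vertex_affinely_independent _ _ D2 (fun j => b (rshift d1.+1 j))).
have b11 : \sum_j b (lshift d2.+1 j) = 0.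
  by move: b0; rewrite big_split_ord /= [X in _ + X]b21 addr0.
have b1 j : b (lshift d2.+1 j) = 0.
  exact: (@vertex_affinely_independent _ _ D1 (fun j => b (lshift d2.+1 j))).
by case: (split_ordP i) => j ->.
Qed.

Definition join_simplex (R : realType) d1 d2 (D1 : lattice_simplex R d1)
    (D2 : lattice_simplex R d2) : lattice_simplex R (d1 + d2 + 1) :=
  LatticeSimplex (@join_affinely_independent R d1 d2 D1 D2).

Lemma Lambda_join (R : realType) d1 d2 (D1 : lattice_simplex R d1)
    (D2 : lattice_simplex R d2) x :
  Lambda (join_simplex D1 D2) x <->
  set_join (Lambda D1) (Lambda D2) (castmx (erefl, join_dim d1 d2) x).
Proof.
set y := castmx _ x.
have yE i : x 0 (cast_ord (esym (join_dim d1 d2)) i) = y 0 i.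
  by rewrite castmxE cast_ord_id.
have sumE : \sum_i x 0 i = \sum_i y 0 i.
  by rewrite (sum_cast_ord (join_dim d1 d2)); apply: eq_bigr.
have sumvE : \sum_i x 0 i *: latR R (vertex (join_simplex D1 D2) i) =
    \sum_i y 0 i *: latR R (join_vertex D1 D2 i).
  rewrite (sum_cast_ord (join_dim d1 d2)); apply: eq_bigr => i _ /=.
  by rewrite cast_ordKV yE.
have suml : \sum_i lsubmx y 0 i = \sum_i y 0 (lshift _ i).
  by apply: eq_bigr => i _; rewrite mxE.
have sumr : \sum_i rsubmx y 0 i = \sum_i y 0 (rshift _ i).
  by apply: eq_bigr => i _; rewrite mxE.
have sumvl : \sum_i lsubmx y 0 i *: latR R (vertex D1 i) =
    \sum_i y 0 (lshift _ i) *: latR R (vertex D1 i).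
  by apply: eq_bigr => i _; rewrite mxE.
have sumvr : \sum_i rsubmx y 0 i *: latR R (vertex D2 i) =
    \sum_i y 0 (rshift _ i) *: latR R (vertex D2 i).
  by apply: eq_bigr => i _; rewrite mxE.
rewrite /set_join /= !Lambda_sumP sumE sumvE suml sumr sumvl sumvr.
rewrite join_vertex_sum !latR_row_mx big_split_ord /=.
(* The last coordinate makes the second block sum integral; the total being integral, so is the
   first block sum. *)
split=> [[[[m1 m2] /latR_int c] s]|[[m1 l] [m2 r]]].
  have r : \sum_i y 0 (rshift _ i) \is a Num.int by have := c 0 0; rewrite mxE.
  by rewrite (rpredDr _ r) in s.
split; last exact: rpredD.
by split=> //; apply/latR_int => i j; rewrite mxE.
Qed.

Lemma free_join_simplex (R : realType) d1 d2 (D1 : lattice_simplex R d1)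
    (D2 : lattice_simplex R d2) :
  free_join (polytope D1) (polytope D2) = polytope (join_simplex D1 D2).
Proof.
have -> : polytope (join_simplex D1 D2) =
    convex_hull (range (fun i => latR R (join_vertex D1 D2 i))).
  congr convex_hull; apply/seteqP; split=> _ [i _ <-].
    by exists (cast_ord (join_dim d1 d2) i).
  by exists (cast_ord (esym (join_dim d1 d2)) i) => //=; rewrite cast_ordKV.
(* The two embeddings in the join are affine, so each embedded polytope is the hull of its embedded
   vertices; the hull of the union of these two hulls is the hull of all the vertices. *)
pose A1 : 'M[R]_(d1, d1 + d2 + 1) := row_mx (row_mx 1%:M 0) 0.
pose A2 : 'M[R]_(d2, d1 + d2 + 1) := row_mx (row_mx 0 1%:M) 0.
pose b : 'rV[R]_(d1 + d2 + 1) := row_mx 0 (const_mx 1).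
have A1E x : row_mx (row_mx x 0) (const_mx 0) = x *m A1 + 0.
  by rewrite addr0 !mul_mx_row mulmx1 !mulmx0.
have A2E x : row_mx (row_mx 0 x) (const_mx 1) = x *m A2 + b.
  by rewrite !mul_mx_row mulmx1 !mulmx0 add_row_mx addr0 add0r.
have v1E i : latR R (vertex D1 i) *m A1 + 0 =
    latR R (join_vertex D1 D2 (lshift _ i)).
  rewrite -A1E /join_vertex (unsplitK (inl _)) /latR !map_row_mx map_mx0.
  by rewrite map_const_mx.
have v2E i : latR R (vertex D2 i) *m A2 + b =
    latR R (join_vertex D1 D2 (rshift _ i)).
  rewrite -A2E /join_vertex (unsplitK (inr _)) /latR !map_row_mx map_mx0.
  by rewrite map_const_mx.
rewrite /free_join.
under eq_imagel do rewrite A1E.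
under [X in _ `|` X]eq_imagel do rewrite A2E.
rewrite !affine_image_hull; apply/seteqP; split; apply: smallest_sub.
- exact: convex_hull_convex.
- move=> x [|]; apply: smallest_sub; try exact: convex_hull_convex.
    by move=> _ [i _ <-]; apply: sub_gen_smallest; exists (lshift _ i).
  by move=> _ [i _ <-]; apply: sub_gen_smallest; exists (rshift _ i).
- exact: convex_hull_convex.
- move=> _ [i _ <-]; apply: sub_gen_smallest.
  case: (split_ordP i) => j ->; [left|right]; rewrite -?v1E -?v2E;
    by apply: sub_gen_smallest; exists j.
Qed.

(** * Comparing the two isomorphism relations through [Lambda] *)

Lemma castmx_col_perm (T : Type) m n n' (e : n = n') (s : 'S_n)
    (A : 'M[T]_(m, n)) :
  castmx (erefl, e) (col_perm s A) = col_perm (cast_perm e s) (castmx (erefl, e) A).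
Proof. by case: _ / e; rewrite cast_perm_id !castmx_id. Qed.

Theorem lemma2p9 (R : realType) (d d1 d2 : nat) (D : lattice_simplex R d)
    (D1 : lattice_simplex R d1) (D2 : lattice_simplex R d2) :
  lattice_iso (polytope D) (free_join (polytope D1) (polytope D2)) <->
  code_iso (code_of D) (direct_sum (code_of D1) (code_of D2)).
Proof.
rewrite free_join_simplex (code_iso_encodes (encodes_code_of D)
  (encodes_direct_sum (encodes_code_of D1) (encodes_code_of D2))).
split=> [iso|[e [s LE]]].
  have e : d = (d1 + d2 + 1)%N by case: iso.
  subst d; move/lattice_iso_vertices/Lambda_affine_equiv: iso => [s LE].
  exists (join_dim d1 d2), (cast_perm (join_dim d1 d2) s) => x.
  by rewrite LE Lambda_join castmx_col_perm.
(* Equal code lengths force equal dimensions, since a simplex has one vertex more than its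
   dimension. *)
have ed : d = (d1 + d2 + 1)%N by apply: succn_inj; rewrite join_dim.
subst d; apply/lattice_iso_vertices.
(* The permutation [s] acts on the coordinates of the direct sum; it is carried back along [e] to
   the vertex indices of the join. *)
apply: (@affine_equiv_Lambda _ _ _ _ (cast_perm (esym e) s)) => x.
rewrite LE Lambda_join (eq_irrelevance (join_dim d1 d2) e) castmx_col_perm.
by rewrite cast_permKV.
Qed.
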